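(* Let $P$ be the transition kernel of a $\pi$-irreducible Markov chain that is reversible with respect to its invariant probability measure $\pi$ and non-negative definite. Assume that there exists a set $A\in\mathscr{B}(X)$ with $\pi(A)>0$ such that, for some constant $\delta>0$ and some probability measure $\nu$ on $\mathscr{B}(X)$, $$P(x,B)\ge\delta 1_A(x)\nu(B),\qquad x\in X,\ B\in\mathscr{B}(X),$$ and $M:=\sup_{x\in X}\mathbb{E}_x[\sigma_A]<\infty$. Let $\widetilde P$ be a transition kernel on the same space with invariant probability measure $\widetilde\pi$. Then for all $1<\lambda<e^{1/M}$ satisfying $\lambda<(1+\delta\lambda)(1-M\log\lambda)$ and all $n\ge1$, $$\|\widetilde P^n-P^n\|\le\frac{\lambda}{\lambda-1}\Bigl[\Bigl(D_2+\frac{E_2}{\lambda-1}\Bigr)-\Bigl(D_2+\frac{E_2}{\lambda-1}+E_2n\Bigr)\lambda^{-n}\Bigr]\|\widetilde P-P\|,$$ and $$\|\widetilde\pi-\pi\|_{\mathrm{Var}}\le\frac{\lambda}{\lambda-1}\Bigl(D_2+\frac{E_2}{\lambda-1}\Bigr)\|\widetilde P-P\|,$$ where $$D_2=C_2+(2-C_2)^+\lambda^{-1}M_2,\qquad E_2=C_2(1-\lambda^{-1})M_2,$$ $$C_2=\bigl((\delta\pi(A))^{-1}-1\bigr)^{1/2},\qquad M_2=\frac{\delta\lambda}{(1+\delta\lambda)(1-M\log\lambda)-\lambda}.$$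
   Context: $\Phi=\{\Phi_n:n\in\mathbb{Z}_+\}$ is a discrete-time homogeneous Markov chain on a general state space $X$ with countably generated $\sigma$-field $\mathscr{B}(X)$ and $n$-step transition kernel $P^n(x,B)=\mathbb{P}_x\{\Phi_n\in B\}$; $\mathbb{P}_x,\mathbb{E}_x$ are probability and expectation given $\Phi_0=x$. The chain has a (unique) invariant probability measure $\pi$ and is $\pi$-irreducible: if $\pi(B)>0$, there exists $n\in\mathbb{N}$ such that $P^n(x,B)>0$ for all $x\in X$. It is assumed that $P^n(x,\cdot)\ll\pi$ ($n\ge1$), with density $p^n(x,y)$. Reversible: $\pi(dx)P(x,dy)=\pi(dy)P(y,dx)$. Non-negative definite: $\int_X f(x)Pf(x)\,\pi(dx)\ge0$ for all $f\in L^2(\pi,X)$, where $Pf(x)=\int f(y)P(x,dy)$. $\sigma_A=\inf\{n\ge0:\Phi_n\in A\}$. For a signed measure $\mu$, $\|\mu\|_{\mathrm{Var}}=\sup_{|f|\le1}|\mu(f)|$; $\|\widetilde P^n-P^n\|=\sup_{x\in X}\|\widetilde P^n(x,\cdot)-P^n(x,\cdot)\|_{\mathrm{Var}}$. $a^+=\max\{a,0\}$. *)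

(* Defs.v *)
From HB Require Import structures.
From mathcomp Require Import all_boot all_order all_algebra.
From mathcomp Require Import all_classical all_reals all_analysis.

Set Implicit Arguments.
Unset Strict Implicit.
Unset Printing Implicit Defensive.
Import Order.TTheory GRing.Theory Num.Theory.
Import numFieldNormedType.Exports.

Local Open Scope classical_set_scope.
Local Open Scope ring_scope.
Local Open Scope ereal_scope.

Definition countably_generated (d : measure_display) (X : measurableType d) :=
  exists2 G : set (set X), countable G & (measurable : set (set X)) = <<s G >>.

Section kernel_power.
Context (d : measure_display) (X : measurableType d) (R : realType).
Implicit Types P Q : R.-pker X ~> X.

Definition kcompp P Q : X -> {measure set X -> \bar R} := mkcomp_noparam P Q.

HB.instance Definition _ P Q := Kernel.on (kcompp P Q).

Let kcompp_prob P Q x : kcompp P Q x setT = 1.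
Proof.
rewrite /kcompp /mkcomp_noparam /= /kcomp_noparam.
under eq_integral do rewrite prob_kernel.
by rewrite integral_cst// mul1e prob_kernel.
Qed.

HB.instance Definition _ P Q :=
  Kernel_isProbability.Build _ _ _ _ _ (kcompp P Q) (@kcompp_prob P Q).

(* P^0(x, .) is the Dirac mass at x and
   P^(n+1)(x, B) = \int P(x, dy) P^n(y, B). *)
Fixpoint kpow P (n : nat) : R.-pker X ~> X :=
  if n is m.+1 then kcompp P (kpow P m) else kdirac (@measurable_id _ X setT).

End kernel_power.

Section markov_chain.
Context (dX dO : measure_display) (X : measurableType dX)
  (Omega : measurableType dO) (R : realType).

(* sigma(Phi_0, ..., Phi_n) *)
Definition history (Phi : nat -> Omega -> X) (n : nat) : set (set Omega) :=
  <<s [set E | exists k B, [/\ (k <= n)%N, measurable B & E = Phi k @^-1` B]] >>.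

(* The third field says that P (Phi_n, B) is a version of the conditional
   probability of {Phi_(n+1) \in B} given sigma(Phi_0, ..., Phi_n).
   The initial condition is put on the law of Phi_0 because singletons
   of X need not be measurable. *)
Record markov_chain (P : R.-pker X ~> X) (Pr : X -> probability Omega R)
    (Phi : nat -> Omega -> X) : Prop := MarkovChain {
  markov_chain_measurable : forall n, measurable_fun setT (Phi n);
  markov_chain_init : forall x (B : set X), measurable B ->
    Pr x (Phi 0%N @^-1` B) = \d_x B;
  markov_chain_step : forall x n (H : set Omega) (B : set X),
    history Phi n H -> measurable B ->
    Pr x (H `&` Phi n.+1 @^-1` B) = \int[Pr x]_(w in H) P (Phi n w) B }.

Definition hitting_time (Phi : nat -> Omega -> X) (A : set X) (w : Omega)
  : \bar R := ereal_inf [set n%:R%:E | n in [set n : nat | A (Phi n w)]].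

End markov_chain.
Arguments hitting_time {dX dO X Omega R}.

Section kernel_properties.
Context (d : measure_display) (X : measurableType d) (R : realType).
Implicit Types (P Q : R.-pker X ~> X) (pi : probability X R).

Definition invariant_prob P pi := forall B : set X, measurable B ->
  pi B = \int[pi]_x P x B.

Definition irreducible_kernel P pi := forall B : set X, measurable B -> 0 < pi B ->
  exists2 n : nat, (0 < n)%N & forall x, 0 < kpow P n x B.

(* Equality of pi(dx)P(x,dy) and pi(dy)P(y,dx) on measurable rectangles. *)
Definition reversible_kernel P pi := forall B C : set X,
  measurable B -> measurable C ->
  \int[pi]_(x in B) P x C = \int[pi]_(y in C) P y B.

Definition nonneg_definite_kernel P pi := forall f : X -> R,
  f \in Lfun pi 2%:E -> (0 <= \int[pi]_x (f x * \int[P x]_y f y))%R.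

(* || m1 - m2 ||_Var, where (m1 - m2)(f) = m1(f) - m2(f). *)
Definition var_dist (m1 m2 : {measure set X -> \bar R}) : \bar R :=
  ereal_sup [set `| \int[m1]_x (f x)%:E - \int[m2]_x (f x)%:E | |
    f in [set f : X -> R | measurable_fun setT f /\
                           forall x, (`|f x| <= 1)%R]].

Definition kernel_dist P Q : \bar R :=
  ereal_sup [set var_dist (P x) (Q x) | x in [set: X]].

End kernel_properties.

Section constants.
Context (R : realType).
Implicit Types delta piA M lam : R.
Local Open Scope ring_scope.

Definition C2 delta piA : R := Num.sqrt ((delta * piA)^-1 - 1).

Definition M2 delta M lam : R :=
  delta * lam / ((1 + delta * lam) * (1 - M * ln lam) - lam).

Definition D2 delta piA M lam : R :=
  C2 delta piA + Num.max (2 - C2 delta piA) 0 * lam^-1 * M2 delta M lam.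

Definition E2 delta piA M lam : R :=
  C2 delta piA * (1 - lam^-1) * M2 delta M lam.

End constants.

(* Main.v *)
(* Write lambda for lam and let Q f = P f - delta 1_A nu(f), the kernel of the
   chain killed at its regenerations (at each visit to A, with probability delta,
   the next state is drawn from nu).

   Hitting times give a bounded Lyapunov function v = 1 + c E[sigma_A] for Q, with
   lambda Q v <= v - eps 1_A: this bounds the exponential moment of the
   regeneration time by M2.

   Let h = dnu/dpi - 1, which is bounded since delta pi(A) nu <= pi, and let
   a_n = nu P^n h = <h, P^n h>, which is nonnegative because P is reversible and
   nonnegative definite. Integrating
   P^n h = Q^n h + sum_j delta a_j Q^(n-1-j) 1_A against pi gives 0 on the left, so
   delta pi(A) a_(n-1) <= - pi(Q^n h) = O(lambda^-n). As ||P^n h||^2 = a_(2n) is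
   log-convex in n, this forces ||P^n h|| <= lambda^-n ||h|| <= C2 lambda^-n, hence
   |nu P^n f - pi f| <= C2 lambda^-n for |f| <= 1.

   The first-regeneration decomposition and an Abel summation turn this into
   |P^n f - pi f| <= (D2 + E2 n) lambda^-n, and the perturbation bounds follow by
   telescoping Pt^n - P^n. All functions involved are bounded. *)

Require Import Defs.
From HB Require Import structures.
From mathcomp Require Import all_boot all_order all_algebra.
From mathcomp Require Import all_classical all_reals all_analysis.
From mathcomp Require Import measurable_realfun ring lra zify.


Set Implicit Arguments.
Unset Strict Implicit.
Unset Printing Implicit Defensive.
Import Order.TTheory GRing.Theory Num.Theory.
Import numFieldNormedType.Exports.

Local Open Scope classical_set_scope.
Local Open Scope ring_scope.

(** * Bounded measurable functions *)

Section bfun.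
Context (d : measure_display) (X : measurableType d) (R : realType).

Definition bounded_measurable : {pred X -> R} :=
  fun f => `[< measurable_fun setT f /\ exists c, forall x, `|f x| <= c >].

Lemma bounded_measurableP (f : X -> R) : reflect
  (measurable_fun setT f /\ exists c, forall x, `|f x| <= c)
  (f \in bounded_measurable).
Proof. exact: asboolP. Qed.

Lemma bounded_measurable_submod : submod_closed bounded_measurable.
Proof.
split=> [|a f g /bounded_measurableP[mf [c fc]] /bounded_measurableP[mg [e ge]]].
  apply/bounded_measurableP; split; first exact: measurable_cst.
  by exists 0 => x; rewrite normr0.
apply/bounded_measurableP; split.
  by apply: measurable_funD => //; apply: measurable_funM => //; exact: measurable_cst.
exists (`|a| * c + e) => x; rewrite (le_trans (ler_normD _ _))// lerD//.
by rewrite normrM ler_wpM2l.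
Qed.

HB.instance Definition _ :=
  GRing.isSubmodClosed.Build R (X -> R) bounded_measurable bounded_measurable_submod.

(** Packing boundedness with measurability gives an lmodule of functions whose integrals against
    probabilities are real numbers, so that measures and kernels act as plain linear maps. *)
Record bfun := BFun { bval :> X -> R; _ : bval \in bounded_measurable }.

HB.instance Definition _ := [isSub for bval].
HB.instance Definition _ := [Choice of bfun by <:].
HB.instance Definition _ := [SubChoice_isSubLmodule of bfun by <:].

Lemma bfun_measurable (f : bfun) : measurable_fun setT f.
Proof. by have /bounded_measurableP[] := valP f. Qed.

Lemma bfun_bounded (f : bfun) : exists c, forall x, `|f x| <= c.
Proof. by have /bounded_measurableP[] := valP f. Qed.

Lemma bfunP (f g : bfun) : f =1 g -> f = g.
Proof. by move=> fg; apply/val_inj/funext. Qed.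

Lemma bfunD (f g : bfun) x : (f + g) x = f x + g x.
Proof. by []. Qed.

Lemma bfunN (f : bfun) x : (- f) x = - f x.
Proof. by []. Qed.

Lemma bfunZ a (f : bfun) x : (a *: f) x = a * f x.
Proof. by []. Qed.

Lemma bfun0 x : (0 : bfun) x = 0.
Proof. by []. Qed.

Lemma bfun_sum I (r : seq I) (p : pred I) (F : I -> bfun) x :
  (\sum_(i <- r | p i) F i) x = \sum_(i <- r | p i) F i x.
Proof. by elim/big_rec2: _ => // i y1 y2 _ <-. Qed.

Fact bcst_subproof (c : R) : cst c \in bounded_measurable.
Proof. by apply/bounded_measurableP; split=> //; exists `|c|. Qed.
Definition bcst c := BFun (bcst_subproof c).

Fact bmul_subproof (f g : bfun) : (fun x => f x * g x) \in bounded_measurable.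
Proof.
apply/bounded_measurableP; split.
  by apply: measurable_funM; exact: bfun_measurable.
have [[c fc] [e ge]] := (bfun_bounded f, bfun_bounded g).
by exists (c * e) => x; rewrite normrM ler_pM.
Qed.
Definition bmul f g := BFun (bmul_subproof f g).

Fact bindic_subproof (B : set X) : measurable B -> \1_B \in bounded_measurable.
Proof.
move=> mB; apply/bounded_measurableP; split; first exact: measurable_indic.
by exists 1 => x; rewrite indicE; case: (_ \in _); rewrite ?normr1 ?normr0.
Qed.
Definition bindic B (mB : measurable B) := BFun (bindic_subproof mB).

Lemma bcst_val c x : bcst c x = c.
Proof. by []. Qed.

Lemma bmul_val f g x : bmul f g x = f x * g x.
Proof. by []. Qed.

Lemma bindic_val A (mA : measurable A) x : bindic mA x = (x \in A)%:R.
Proof. by rewrite /= indicE. Qed.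

Definition bfunE := (bfunD, bfunN, bfunZ, bfun0, bcst_val, bmul_val).

End bfun.

(** * Real sequences *)

Section real_sequences.
Context (R : realType).

Lemma bernoulli_exp (e : R) n : 0 <= e -> 1 + n%:R * e <= (1 + e) ^+ n.
Proof.
move=> e0; elim: n => [|n IH]; first by rewrite mul0r addr0 expr0.
rewrite exprS -natr1.
have := ler_wpM2l (_ : 0 <= 1 + e) IH.
have n0 : 0 <= n%:R :> R by [].
by move=> /(_ ltac:(lra)); nra.
Qed.

Lemma exp_unbounded (q c : R) : 1 < q -> exists n, c < q ^+ n.
Proof.
move=> q1; pose e := q - 1; have e0 : 0 < e by rewrite subr_gt0.
exists (Num.bound (`|c| / e)); rewrite (_ : q = 1 + e); last by rewrite /e; ring.
apply: lt_le_trans (bernoulli_exp _ (ltW e0)).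
rewrite (le_lt_trans (ler_norm c))// -[ltLHS](divfK (lt0r_neq0 e0)).
rewrite ltr_wpDl// ltr_pM2r//.
by rewrite archi_boundP// divr_ge0// ltW.
Qed.

(** Stands in for letting [n] tend to infinity: if [b < a], some power of [lam] exceeds
    [c / (a - b)]. *)
Lemma ler_add_geometric (a b c lam : R) : 1 < lam ->
  (forall n, a <= b + c * lam ^- n) -> a <= b.
Proof.
move=> lam1 abc; rewrite leNgt; apply/negP => ba.
have [n] := exp_unbounded (c / (a - b)) lam1.
have l0 : 0 < lam ^+ n by rewrite exprn_gt0// (lt_trans ltr01).
rewrite ltr_pdivrMr ?subr_gt0// => cn.
have := abc n; rewrite -lerBlDl leNgt ltr_pdivrMr//.
by rewrite mulrC cn.
Qed.

(** Log-convexity makes the ratios [c n.+1 / c n] nondecreasing. A single ratio [q > rho] would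
    force growth at least like [q ^+ k] from then on, against the bound [C * rho ^+ n]. *)
Lemma log_convex_le_geometric (c : nat -> R) (C rho : R) : 0 < rho ->
  (forall n, 0 <= c n) -> (forall n, c n.+1 ^+ 2 <= c n * c n.+2) ->
  (forall n, c n <= C * rho ^+ n) -> forall n, c n <= c 0%N * rho ^+ n.
Proof.
move=> rho0 c0 cc cC.
suff step n : c n.+1 <= rho * c n.
  elim=> [|n IH]; first by rewrite expr0 mulr1.
  by rewrite (le_trans (step n))// exprS mulrCA ler_pM2l.
rewrite leNgt; apply/negP => cn.
have cn0 : 0 < c n.
  rewrite lt_neqAle c0 andbT; apply/eqP => cn0.
  move: (cc n) cn; rewrite -cn0 mul0r mulr0 leNgt.
  by move=> /negP + /exprn_gt0 => + /(_ 2%N); apply.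
pose q := c n.+1 / c n.
have q_rho : rho < q by rewrite ltr_pdivlMr.
have q0 := lt_trans rho0 q_rho.
have grow k : c n * q ^+ k <= c (n + k)%N /\ q * c (n + k)%N <= c (n + k).+1.
  elim: k => [|k [IH1 IH2]].
    by rewrite expr0 mulr1 addn0 divfK// gt_eqF.
  have ck0 : 0 < c (n + k)%N by rewrite (lt_le_trans _ IH1)// mulr_gt0// exprn_gt0.
  have ck1 : 0 < c (n + k).+1 by rewrite (lt_le_trans _ IH2)// mulr_gt0.
  rewrite addnS; split.
    by rewrite exprS mulrCA (le_trans _ IH2)// ler_pM2l.
  rewrite -(ler_pM2l ck0) (le_trans _ (cc _))// mulrA expr2 ler_pM2r//.
  by rewrite mulrC.
have q_rho1 : 1 < q / rho by rewrite ltr_pdivlMr// mul1r.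
have [k] := exp_unbounded (C * rho ^+ n / c n) q_rho1.
rewrite expr_div_n ltr_pdivrMr// mulrAC ltr_pdivlMr ?exprn_gt0// -mulrA -exprD.
rewrite ltNge => /negP; apply; rewrite (le_trans _ (cC _))//.
by rewrite mulrC; have [] := grow k.
Qed.

(** Source of Cauchy-Schwarz. For [c > 0] the form at [s = c], [t = - b] equals
    [c * (a * c - b ^+ 2)]; for [c = 0] and [b != 0] it is negative at [s = b], [t = - (a + 1)]. *)
Lemma discriminant_le (a b c : R) :
  (forall s t, 0 <= s ^+ 2 * a + 2 * (s * t) * b + t ^+ 2 * c) ->
  b ^+ 2 <= a * c.
Proof.
move=> h; have a0 : 0 <= a by have := h 1 0; nra.
have c0 : 0 <= c by have := h 0 1; nra.
have [cgt0|cle0] := ltP 0 c.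
  rewrite -(ler_pM2l cgt0); have := h c (- b); nra.
have cE : c = 0 by apply/eqP; rewrite eq_le cle0.
have [->|b0] := eqVneq b 0; first by rewrite expr0n mulr_ge0.
have := h b (- (a + 1)); rewrite cE.
have : 0 < b ^+ 2 by rewrite exprn_even_gt0.
nra.
Qed.

End real_sequences.

(** * Uniform ergodicity from a minorization and hitting times *)

Lemma iter_is_linear (R : pzRingType) (V : lmodType R) (f : {linear V -> V}) n :
  linear (iter n f).
Proof. by move=> a u v; elim: n => //= n ->; rewrite linearP. Qed.

HB.instance Definition _ (R : pzRingType) (V : lmodType R) (f : {linear V -> V}) n :=
  GRing.isLinear.Build R V V _ (iter n f) (iter_is_linear f n).

(** * Positive linear maps on bounded functions *)

Section positive_maps.
Context (d : measure_display) (X : measurableType d) (R : realType).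
Notation B := (bfun X R).
Implicit Types (f g h : B).

Definition positive_functional (L : B -> R) :=
  forall f, (forall x, 0 <= f x) -> 0 <= L f.

Definition positive_operator (T : B -> B) :=
  forall f, (forall x, 0 <= f x) -> forall x, 0 <= T f x.

Lemma functional_le (L : {scalar B}) f g : positive_functional L ->
  (forall x, f x <= g x) -> L f <= L g.
Proof.
move=> L0 fg; rewrite -subr_ge0 -linearB L0// => x.
by rewrite !bfunE subr_ge0.
Qed.

Lemma operator_le (T : {linear B -> B}) f g : positive_operator T ->
  (forall x, f x <= g x) -> forall x, T f x <= T g x.
Proof.
move=> T0 fg x; rewrite -subr_ge0 -bfunN -bfunD -linearB T0// => y.
by rewrite !bfunE subr_ge0.
Qed.

Lemma positive_iter T n : positive_operator T -> positive_operator (iter n T).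
Proof. by move=> T0 f f0; elim: n => //= n IH; exact: T0. Qed.

Lemma bcstE (c : R) : bcst X c = c *: bcst X 1.
Proof. by apply: bfunP => x; rewrite !bfunE mulr1. Qed.

Lemma operator_leZ (T : {linear B -> B}) f g h a b : positive_operator T ->
  (forall x, a * f x <= g x - b * h x) ->
  forall x, a * T f x <= T g x - b * T h x.
Proof.
move=> T0 fgh x; rewrite -!bfunZ -bfunN -bfunD -!linearZ -linearB.
by apply: operator_le => // y; rewrite !bfunE.
Qed.

Lemma functional_norm_le (L : {scalar B}) f c : positive_functional L ->
  (forall x, `|f x| <= c) -> `|L f| <= c * L (bcst X 1).
Proof.
move=> L0 fc; rewrite -linearZ/= -bcstE ler_norml -linearN.
by apply/andP; split; apply: functional_le => // x; have := fc x;
  rewrite ler_norml !bfunE => /andP[].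
Qed.

Lemma operator_norm_le (T : {linear B -> B}) f c x : positive_operator T ->
  (forall x, `|f x| <= c) -> `|T f x| <= c * T (bcst X 1) x.
Proof.
move=> T0 fc; rewrite -bfunZ -linearZ/= -bcstE ler_norml -bfunN -linearN.
by apply/andP; split; apply: operator_le => // y; have := fc y;
  rewrite ler_norml !bfunE => /andP[].
Qed.

End positive_maps.

(** * Regeneration argument for an abstract positive operator *)

Section regeneration.
Context (d : measure_display) (X : measurableType d) (R : realType).
Notation B := (bfun X R).
Local Notation one := (bcst X (1 : R)).
Context (P : {linear B -> B}) (pi nu : {scalar B}) (iA : B) (delta M lam : R).
Implicit Types f g : B.
Hypotheses (P_ge0 : positive_operator P) (P1 : P one = one).
Hypotheses (pi_ge0 : positive_functional pi) (pi1 : pi one = 1).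
Hypotheses (nu_ge0 : positive_functional nu) (nu1 : nu one = 1).
Hypothesis iA01 : forall x, iA x = 0 \/ iA x = 1.
Hypotheses (piA_gt0 : 0 < pi iA) (delta_gt0 : 0 < delta) (M_ge0 : 0 <= M).
Hypothesis minorization : forall f, (forall x, 0 <= f x) ->
  forall x, delta * nu f * iA x <= P f x.

(* [survival n x] is the probability that the chain started at [x] is outside
   [A] at times 0, ..., n. *)
Definition survival n : B := iter n (fun f : B => bmul (one - iA) (P f)) (one - iA).

Lemma survival0 : survival 0 = one - iA.
Proof. by []. Qed.

Lemma survivalS n : survival n.+1 = bmul (one - iA) (P (survival n)).
Proof. by []. Qed.

Hypothesis survivalM : forall m x, \sum_(n < m) survival n x <= M.
Hypotheses (lam_gt1 : 1 < lam).
Hypothesis lam_small : lam < (1 + delta * lam) * (1 - M * ln lam).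

Let lam_gt0 : 0 < lam. Proof. exact: lt_trans ltr01 _. Qed.
Let L := 1 - M * ln lam.
Let kappa := 1 - lam^-1.

Let L_gt0 : 0 < L.
Proof.
have := lt_trans lam_gt0 lam_small; rewrite pmulr_rgt0//.
by rewrite addr_gt0// mulr_gt0.
Qed.

Let kappa_gt0 : 0 < kappa.
Proof. by rewrite subr_gt0 invf_lt1. Qed.

(** This is [1 - lam^-1 <= ln lam]. The Lyapunov functions are naturally bounded by
    [(1 - M * kappa)^-1]; weakening this to [L^-1] brings the logarithm into the constants. *)
Let L_le : L <= 1 - M * kappa.
Proof.
rewrite lerD2l lerN2 ler_wpM2l//.
have lamV_gt0 : 0 < lam^-1 by rewrite invr_gt0.
have /le_ln1Dx : -1 < lam^-1 - 1 by rewrite ltrBrDr addNr.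
have -> : 1 + (lam^-1 - 1) = lam^-1 by ring.
by rewrite lnV ?posrE// lerNl opprB.
Qed.

(* [t m x] is the expectation of min (sigma_A, m) from [x], and [v m] is a truncated
   Lyapunov function: the truncation index drops by one at each step. *)
Let t m := \sum_(n < m) survival n.
Let v m := one + (kappa / (1 - M * kappa)) *: t m.

Let survival_ge0 n x : 0 <= survival n x.
Proof.
have iAc x' : 0 <= 1 - iA x' by have [->|->] := iA01 x'; rewrite ?subr0// subrr.
elim: n x => [|n IH] x; first by rewrite survival0 !bfunE.
by rewrite survivalS !bfunE mulr_ge0 ?P_ge0.
Qed.

Let survival_in n x : iA x = 1 -> survival n x = 0.
Proof.
by case: n => [|n] Ax; rewrite ?survival0 ?survivalS !bfunE Ax subrr ?mul0r.
Qed.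

Let t_in m x : iA x = 1 -> t m x = 0.
Proof. by move=> Ax; rewrite bfun_sum big1// => n _; rewrite survival_in. Qed.

Let t_out m x : iA x = 0 -> t m.+1 x = 1 + P (t m) x.
Proof.
move=> Ax; rewrite /t linear_sum !bfun_sum big_ord_recl survival0 !bfunE Ax subr0.
by congr (_ + _); apply: eq_bigr => i _; rewrite survivalS !bfunE Ax subr0 mul1r.
Qed.

Let one_sub_gt0 : 0 < 1 - M * kappa. Proof. exact: lt_le_trans L_le. Qed.

Let coef_ge0 : 0 <= kappa / (1 - M * kappa).
Proof. by rewrite divr_ge0 ?ltW. Qed.

Let v_ge1 m x : 1 <= v m x.
Proof.
by rewrite !bfunE lerDl mulr_ge0// bfun_sum sumr_ge0.
Qed.

Let v_le_inv m x : v m x <= (1 - M * kappa)^-1.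
Proof.
rewrite !bfunE bfun_sum.
rewrite [leRHS](_ : _ = 1 + kappa / (1 - M * kappa) * M).
  by rewrite lerD2l ler_wpM2l.
by field; rewrite gt_eqF.
Qed.

Let v_le m x : v m x <= L^-1.
Proof. by rewrite (le_trans (v_le_inv _ _))// lef_pV2 ?posrE. Qed.

Let v_in m x : iA x = 1 -> v m x = 1.
Proof. by move=> Ax; rewrite !bfunE t_in// mulr0 addr0. Qed.

(** Off [A] the recursion for [t] gives [P (v m) = v m.+1 - c] with [c = kappa / (1 - M * kappa)].
    This [c] is [kappa] times the upper bound of [v], hence at least [kappa * v m.+1], which leaves
    at most [v m.+1 / lam]. *)
Let v_out m x : iA x = 0 -> lam * P (v m) x <= v m.+1 x.
Proof.
move=> Ax; rewrite -ler_pdivlMl//.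
have -> : P (v m) x = v m.+1 x - kappa / (1 - M * kappa).
  by rewrite /v linearD linearZ P1 !bfunE t_out//; ring.
rewrite lerBlDr -lerBlDl.
have -> : v m.+1 x - lam^-1 * v m.+1 x = kappa * v m.+1 x.
  by rewrite /kappa; ring.
by rewrite ler_pM2l.
Qed.

(** * Drift and mass of the killed operator Q *)

Definition taboo f := P f - (delta * nu f) *: iA.

Lemma tabooE f x : taboo f x = P f x - delta * nu f * iA x.
Proof. by []. Qed.

Fact taboo_is_linear : linear taboo.
Proof.
move=> a f g; apply: bfunP => x.
by rewrite /taboo !linearP !bfunE /=; ring.
Qed.

HB.instance Definition _ := GRing.isLinear.Build R B B _ taboo taboo_is_linear.

Lemma taboo_ge0 : positive_operator taboo.
Proof. by move=> f f0 x; rewrite tabooE subr_ge0 minorization. Qed.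

(** The drift margin on [A]: there [v m.+1 = 1], while [v m <= L^-1] and [1 <= nu (v m)] bound
    [lam * taboo (v m)] by [lam * (L^-1 - delta) = 1 - eps]. Hypothesis [lam_small] amounts to
    [0 < eps]. *)
Let eps := 1 + delta * lam - lam / L.

Let eps_gt0 : 0 < eps.
Proof. by rewrite subr_gt0 ltr_pdivrMr. Qed.

Let taboo_v m x : lam * taboo (v m) x <= v m.+1 x - eps * iA x.
Proof.
rewrite tabooE.
have [Ax|Ax] := iA01 x; rewrite Ax.
  by rewrite !mulr0 !subr0 v_out.
rewrite v_in// !mulr1.
have h1 : P (v m) x <= L^-1.
  have -> : L^-1 = (L^-1 *: one) x by rewrite !bfunE mulr1.
  by rewrite -P1 -linearZ operator_le// => y; have := v_le m y; rewrite !bfunE mulr1.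
have h2 : 1 <= nu (v m) by rewrite -nu1 functional_le.
apply: (@le_trans _ _ (lam * (L^-1 - delta))).
  by rewrite ler_pM2l// lerB// -[leLHS]mulr1 ler_pM2l//.
by rewrite /eps le_eqVlt; apply/orP; left; apply/eqP; ring.
Qed.

(** Telescoping of the drift inequality; each application of [taboo] uses up one unit of the
    truncation index. *)
Let taboo_sum_le N m x :
  eps * (\sum_(n < N) lam ^+ n * iter n taboo iA x)
    + lam ^+ N * iter N taboo (v m) x <= v (m + N)%N x.
Proof.
elim: N m => [|N IH] m; first by rewrite big_ord0 mulr0 add0r mul1r addn0.
rewrite addnS -addSn (le_trans _ (IH m.+1))// iterSr.
rewrite big_ord_recr mulrDr -addrA lerD2l.
have := operator_leZ (positive_iter N taboo_ge0) (taboo_v m) x.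
move=> /(ler_wpM2l (exprn_ge0 N (ltW lam_gt0))).
by rewrite exprSr; lra.
Qed.

Let iA_ge0 x : 0 <= iA x. Proof. by have [->|->] := iA01 x. Qed.

Let taboo_iA_ge0 n x : 0 <= iter n taboo iA x.
Proof. by apply: positive_iter; first exact: taboo_ge0. Qed.

(** A crude decay rate, used for remainders and for a constant that is later discarded. *)
Lemma taboo_iter_le n x : lam ^+ n * iter n taboo one x <= L^-1.
Proof.
have := taboo_sum_le n 0 x; have -> : v 0 = one.
  by apply: bfunP => y; rewrite bfunD bfunZ bfun_sum big_ord0 mulr0 addr0.
have := v_le (0 + n) x.
have : 0 <= eps * \sum_(k < n) lam ^+ k * iter k taboo iA x.
  rewrite mulr_ge0 ?(ltW eps_gt0)// sumr_ge0// => k _.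
  by rewrite mulr_ge0 ?exprn_ge0 ?(ltW lam_gt0)// taboo_iA_ge0.
lra.
Qed.

(** [delta * iter k taboo iA x] is the probability of a first regeneration at step [k + 1], so the
    sum is a truncated exponential moment of that time. *)
Lemma regeneration_sum_le n x :
  \sum_(k < n) delta * lam ^+ k.+1 * iter k taboo iA x <= M2 delta M lam.
Proof.
(* The denominator of [M2] is [eps * L]. *)
have -> : M2 delta M lam = delta * lam / eps * L^-1.
  rewrite /M2 /eps -/L; field.
  rewrite !gt_eqF// subr_gt0//.
rewrite -ler_pdivrMl ?divr_gt0// ?mulr_gt0// invf_div mulrC.
have := taboo_sum_le n 0 x; have := v_le (0 + n) x.
have : 0 <= lam ^+ n * iter n taboo (v 0) x.
  rewrite mulr_ge0 ?exprn_ge0 ?(ltW lam_gt0)//.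
  apply: positive_iter; first exact: taboo_ge0.
  by move=> y; rewrite (le_trans ler01).
set S := \sum_(k < n) _.
have -> : \sum_(k < n) delta * lam ^+ k.+1 * iter k taboo iA x = delta * lam * S.
  by rewrite mulr_sumr; apply: eq_bigr => k _; rewrite exprS; ring.
have -> : delta * lam * S * (eps / (delta * lam)) = eps * S.
  by field; rewrite !gt_eqF.
lra.
Qed.

Lemma taboo_massS n x :
  iter n.+1 taboo one x = iter n taboo one x - delta * iter n taboo iA x.
Proof.
rewrite iterSr (_ : taboo one = one - delta *: iA).
  by rewrite linearB linearZ.
by apply: bfunP => y; rewrite tabooE P1 nu1 mulr1.
Qed.

(** The probability of no regeneration in [n] steps is a sum of later regeneration probabilities,
    whose weights in the exponential moment are at least [lam ^+ n.+1], as in Markov's inequality.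
    The mass left at time [n + m] vanishes as [m] grows. *)
Lemma taboo_mass_le n x : lam ^+ n.+1 * iter n taboo one x <= M2 delta M lam.
Proof.
apply: (@ler_add_geometric _ _ _ (lam * L^-1) lam) => // m.
have -> : iter n taboo one x =
    iter (n + m) taboo one x + \sum_(k < m) delta * iter (n + k) taboo iA x.
  elim: m => [|m IH]; first by rewrite big_ord0 addr0 addn0.
  by rewrite big_ord_recr addnS taboo_massS /= IH; ring.
have lm : 0 < lam ^+ m by rewrite exprn_gt0.
rewrite mulrDr addrC; apply: lerD; last first.
  have := ler_wpM2l (ltW lam_gt0) (taboo_iter_le (n + m) x).
  move=> h; rewrite ler_pdivlMr//.
  apply: le_trans h; rewrite le_eqVlt exprD exprS.
  by apply/orP; left; apply/eqP; ring.
apply: le_trans (regeneration_sum_le (n + m) x).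
rewrite big_split_ord /= -[leLHS]add0r; apply: lerD.
  by apply: sumr_ge0 => k _; rewrite !mulr_ge0 ?exprn_ge0 ?(ltW lam_gt0)// ltW.
rewrite mulr_sumr; apply: ler_sum => k _; rewrite mulrCA -mulrA.
rewrite ler_pM2l// ler_wpM2r// ler_weXn2l ?(ltW lam_gt1)//.
by rewrite ltnS leq_addr.
Qed.

(** Here [j] is the number of steps left after the first regeneration. In the induction, the new
    term [j = n] is an immediate regeneration. *)
Lemma first_regeneration n f : iter n P f = iter n taboo f
  + \sum_(j < n) (delta * nu (iter j P f)) *: iter (n - j.+1) taboo iA.
Proof.
elim: n => [|n IH]; first by rewrite big_ord0 addr0.
have PE g : P g = taboo g + (delta * nu g) *: iA by rewrite /taboo subrK.
rewrite iterS PE {1}IH linearD linear_sum -iterS -addrA big_ord_recr subnn.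
congr (_ + (_ + _)); apply: eq_bigr => j _.
by rewrite subSS -(subnSK (ltn_ord j)) iterS; exact: linearZ.
Qed.

(** * Reversibility and the decay of [h] *)

Context (dens : B).
Hypothesis pi_inv : forall f, pi (P f) = pi f.
Hypothesis pi_sym : forall f g, pi (bmul f (P g)) = pi (bmul (P f) g).
Hypothesis pi_nnd : forall f, 0 <= pi (bmul f (P f)).
Hypothesis nu_dens : forall f, nu f = pi (bmul dens f).
Hypothesis dens_ge0 : forall x, 0 <= dens x.
Hypothesis dens_le : forall x, dens x <= (delta * pi iA)^-1.

Let h := dens - one.

Let pi_iter n f : pi (iter n P f) = pi f.
Proof. by elim: n => //= n IH; rewrite pi_inv. Qed.

Let pi_iter_sym n f g : pi (bmul f (iter n P g)) = pi (bmul (iter n P f) g).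
Proof. by elim: n f => //= n IH f; rewrite pi_sym IH -iterSr. Qed.

Let pi_dens : pi dens = 1.
Proof.
by rewrite -nu1 nu_dens; congr (pi _); apply: bfunP => x; rewrite !bfunE mulr1.
Qed.

Let pi_h : pi h = 0.
Proof. by rewrite linearB /= pi_dens pi1 subrr. Qed.

Let nu_h f : pi f = 0 -> nu f = pi (bmul h f).
Proof.
move=> f0; rewrite nu_dens -[LHS]subr0 -{1}f0 -linearB; congr (pi _).
by apply: bfunP => x; rewrite !bfunE; ring.
Qed.

Let nu_iter f n : pi f = 0 -> nu (iter n P f) = pi (bmul (iter n P h) f).
Proof. by move=> f0; rewrite nu_h ?pi_iter// pi_iter_sym. Qed.

Let pi_sqr_ge0 f : 0 <= pi (bmul f f).
Proof. by apply: pi_ge0 => x; rewrite bmul_val -expr2 sqr_ge0. Qed.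

Let nu_iter_even m : nu (iter (m + m) P h) = pi (bmul (iter m P h) (iter m P h)).
Proof. by rewrite nu_iter// iterD -pi_iter_sym. Qed.

(** By self-adjointness an even power gives the square norm of [iter m P h], and an odd one the form
    of [P] at that function, nonnegative by [pi_nnd]. *)
Let nu_iter_ge0 n : 0 <= nu (iter n P h).
Proof.
rewrite -(odd_double_half n) -addnn; case: odd; last by rewrite nu_iter_even.
by rewrite add1n iterS nu_h ?pi_inv ?pi_iter// iterD -iterS iterSr pi_iter_sym.
Qed.

(* Integrating the first-regeneration decomposition of [h] against [pi] gives a
   vanishing sum whose regeneration terms are all nonnegative, so each of them
   is bounded by the geometrically small taboo term. *)
Let nu_iter_le : exists C, forall n, nu (iter n P h) <= C * lam ^- n.
Proof.
have [c hc] := bfun_bounded h.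
exists (c * L^-1 / (delta * pi iA)) => n.
have := congr1 pi (first_regeneration n.+1 h).
(* The term [j = n] has no power of [taboo] left and contributes
   [delta * nu (iter n P h) * pi iA]. *)
rewrite pi_iter pi_h linearD linear_sum big_ord_recr subnn /= linearZ /=.
set S := \sum_(j < n) _; move=> e0.
have S0 : 0 <= S.
  apply: sumr_ge0 => j _; rewrite linearZ /= mulr_ge0//.
    by rewrite mulr_ge0// ltW.
  exact: pi_ge0.
have ln : 0 < lam ^+ n by rewrite exprn_gt0.
have : `|pi (iter n.+1 taboo h)| <= c * L^-1 * lam ^- n.
  rewrite -[leRHS]mulr1 -pi1; apply: functional_norm_le => // x.
  have c0 : 0 <= c by rewrite (le_trans (normr_ge0 (h x))).
  have Th := operator_norm_le x (positive_iter n.+1 taboo_ge0) hc.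
  rewrite (le_trans Th)// -mulrA ler_wpM2l// ler_pdivlMr//.
  have := taboo_iter_le n.+1 x; apply: le_trans; rewrite mulrC ler_wpM2r//.
    by apply: positive_iter => //; exact: taboo_ge0.
  by rewrite ler_weXn2l ?(ltW lam_gt1).
have dA : 0 < delta * pi iA by rewrite mulr_gt0.
rewrite ler_norml => /andP[hT _]; rewrite [leRHS]mulrAC ler_pdivlMr//.
by move: e0; rewrite /=; lra.
Qed.

Let cauchy_schwarz f g :
  pi (bmul f g) ^+ 2 <= pi (bmul f f) * pi (bmul g g).
Proof.
apply: discriminant_le => a b.
have := pi_sqr_ge0 (a *: f + b *: g); congr (_ <= _).
transitivity (pi (a ^+ 2 *: bmul f f + (2 * (a * b)) *: bmul f g
                  + b ^+ 2 *: bmul g g)); last by rewrite !linearD !linearZ.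
by congr (pi _); apply: bfunP => x; rewrite !bfunE; ring.
Qed.

(** The constant of [nu_iter_le] is not sharp; log-convexity of the even subsequence replaces it by
    the value at 0. *)
Let nu_iter_even_le m : nu (iter (m + m) P h) <= nu h * (lam ^- 2) ^+ m.
Proof.
have [C hC] := nu_iter_le.
apply: (@log_convex_le_geometric _ (fun k => nu (iter (k + k) P h)) C) => //.
- by rewrite invr_gt0 exprn_gt0.
(* Cauchy-Schwarz on [iter n P h] and [iter n.+2 P h], whose inner product is the square norm of
   [iter n.+1 P h]. *)
- move=> n; rewrite addSnnS addnC iterD nu_iter ?pi_iter// mulrC.
  by rewrite !nu_iter_even cauchy_schwarz.
- move=> n; rewrite exprVn -exprM mul2n -addnn; exact: hC.
Qed.

(** [Num.sqrt] is 0 on negative reals, so the radicand must be shown nonnegative: [dens] has mean 1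
    and is bounded by [(delta * pi iA)^-1]. *)
Let sqr_C2 : C2 delta (pi iA) ^+ 2 = (delta * pi iA)^-1 - 1.
Proof.
rewrite sqr_sqrtr// subr_ge0 -pi_dens.
have -> : (delta * pi iA)^-1 = pi (bcst X (delta * pi iA)^-1).
  by rewrite bcstE linearZ/= pi1 mulr1.
exact: functional_le.
Qed.

Let nu_h_le : nu h <= C2 delta (pi iA) ^+ 2.
Proof.
rewrite sqr_C2 linearB /= nu1 lerB// nu_dens.
apply: (@le_trans _ _ (pi ((delta * pi iA)^-1 *: dens))).
  by apply: functional_le => // x; rewrite !bfunE ler_wpM2r.
by rewrite linearZ/= pi_dens mulr1.
Qed.

Let C2_ge0 : 0 <= C2 delta (pi iA). Proof. exact: sqrtr_ge0. Qed.

Let center f := f - pi f *: one.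

Let pi_center f : pi (center f) = 0.
Proof. by rewrite linearB linearZ /= pi1 mulr1 subrr. Qed.

(** Cauchy-Schwarz between [iter m P h] and [center f]. The second norm is at most 1, not 2, because
    the variance of [f] is at most [pi (bmul f f)]. *)
Let nu_center_le f m : (forall x, `|f x| <= 1) ->
  `|nu (iter m P (center f))| <= C2 delta (pi iA) * lam ^- m.
Proof.
move=> f1; have lm : 0 <= lam ^- m by rewrite invr_ge0 exprn_ge0// ltW.
rewrite -(ler_pXn2r (_ : 0 < 2)%N) ?nnegrE ?mulr_ge0// real_normK ?num_real//.
rewrite nu_iter// (le_trans (cauchy_schwarz _ _))// -nu_iter_even.
rewrite -[leRHS]mulr1 ler_pM//.
  rewrite (le_trans (nu_iter_even_le m))// exprMn -!exprVn -!exprM (mulnC m).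
  by rewrite ler_wpM2r// exprn_ge0// invr_ge0 ltW.
have -> : bmul (center f) (center f) =
    bmul f f - (2 * pi f) *: f + (pi f ^+ 2) *: one.
  by apply: bfunP => x; rewrite !bfunE; ring.
rewrite linearD linearB !linearZ /= pi1 [_ *: _]mulrN.
have : pi (bmul f f) <= 1.
  rewrite -pi1; apply: functional_le => // x; rewrite !bfunE -expr2.
  by rewrite -[_ ^+ 2]ger0_norm ?sqr_ge0// normrX exprn_ile1.
have := sqr_ge0 (pi f); lra.
Qed.

(** In the first-regeneration decomposition of [center f] the killed term is at most [2 * q n], and
    a regeneration with [j] steps left costs [C * lam ^- j]. Summation by parts yields a term
    [- C * lam ^+ n * q n], which merges with the killed term into the factor [2 - C] of [D2]; the
    remaining sum of masses is linear in [n] and gives [E2]. *)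
Lemma uniform_ergodicity f n x : (forall y, `|f y| <= 1) ->
  `|iter n P f x - pi f| <=
    (D2 delta (pi iA) M lam + E2 delta (pi iA) M lam * n%:R) * lam ^- n.
Proof.
move=> f1; have ln : 0 < lam ^+ n by rewrite exprn_gt0.
set C := C2 delta (pi iA); set K := M2 delta M lam.
have -> : iter n P f x - pi f = iter n P (center f) x.
  have P1n : iter n P one = one by elim: n {ln} => //= n ->.
  have -> : iter n P (center f) = iter n P f - pi f *: one.
    by rewrite -{1}P1n linearB; congr (_ - _); exact: linearZ.
  by rewrite bfunD bfunN bfunZ mulr1.
pose q k := iter k taboo one x; pose r k := delta * iter k taboo iA x.
have qr k : q k.+1 = q k - r k by exact: taboo_massS.
have r0 k : 0 <= r k by rewrite mulr_ge0// ltW.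
have q_ge0 k : 0 <= q k by apply: positive_iter => //; exact: taboo_ge0.
have center2 y : `|center f y| <= 2.
  rewrite !bfunE mulr1 (le_trans (ler_normB _ _))// (_ : 2 = 1 + 1)// lerD//.
  by rewrite -[leRHS]mulr1 -{2}pi1; apply: functional_norm_le.
(* Summation by parts from [r k = q k - q k.+1] and [q 0 = 1]. *)
have abel : \sum_(j < n) r (n - j.+1)%N * lam ^- j * lam ^+ n =
    1 - lam ^+ n * q n + (lam - 1) * \sum_(k < n) lam ^+ k * q k.
  transitivity (\sum_(k < n) lam ^+ k.+1 * r k).
    rewrite (reindex_inj rev_ord_inj) /=; apply: eq_bigr => k _.
    rewrite subnS subKn//= -[in lam ^+ n](subnK (ltn_ord k)) exprD.
    by field; rewrite gt_eqF// exprn_gt0.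
  elim: n {ln} => [|m IH].
    by rewrite !big_ord0 mulr0 addr0 mul1r subrr.
  by rewrite !big_ord_recr /= IH qr exprS; ring.
rewrite -ler_pdivrMr ?invr_gt0// invrK first_regeneration bfunD bfun_sum.
apply: (@le_trans _ _
  ((2 * q n + \sum_(j < n) C * (r (n - j.+1)%N * lam ^- j)) * lam ^+ n)).
  rewrite ler_pM2r// (le_trans (ler_normD _ _))// lerD//.
    exact: (operator_norm_le x (positive_iter n taboo_ge0) center2).
  rewrite (le_trans (ler_norm_sum _ _ _))//; apply: ler_sum => j _.
  rewrite bfunZ !normrM (ger0_norm (taboo_iA_ge0 _ _)) (gtr0_norm delta_gt0).
  rewrite [leRHS](_ : _ = delta * (C * lam ^- j) * iter (n - j.+1) taboo iA x).
    by rewrite ler_wpM2r// ler_pM2l// nu_center_le.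
  by rewrite /r; ring.
have qK k : lam ^+ k * q k <= lam^-1 * K.
  by rewrite ler_pdivlMl// mulrA -exprS taboo_mass_le.
have sum_q : (lam - 1) * \sum_(k < n) lam ^+ k * q k <= (1 - lam^-1) * K * n%:R.
  have : \sum_(k < n) lam ^+ k * q k <= n%:R * (lam^-1 * K).
    rewrite mulr_natl -[X in _ *+ X]card_ord -sumr_const.
    exact: ler_sum.
  have lam1 : 0 <= lam - 1 by rewrite subr_ge0 ltW.
  move=> /(ler_wpM2l lam1) /le_trans; apply; rewrite le_eqVlt; apply/orP; left.
  by apply/eqP; field; rewrite gt_eqF.
rewrite -mulr_sumr mulrDl -[C * _ * _]mulrA mulr_suml abel.
have qn_ge0 : 0 <= lam ^+ n * q n by rewrite mulr_ge0// ltW.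
(* The sign of [2 - C] is unknown, and the upper bound on [q n] is of use only when it is
   positive. *)
have : (2 - C) * (lam ^+ n * q n) <= Num.max (2 - C) 0 * (lam^-1 * K).
  apply: (@le_trans _ _ (Num.max (2 - C) 0 * (lam ^+ n * q n))).
    by rewrite ler_wpM2r// le_max lexx.
  by rewrite ler_wpM2l// le_max lexx orbT.
have := ler_wpM2l C2_ge0 sum_q; rewrite -/C /D2 /E2 -/C -/K.
lra.
Qed.

End regeneration.

(** * Integrals as positive functionals *)

Section layer_cake.
Context (d : measure_display) (X : measurableType d) (R : realType).
Notation B := (bfun X R).

Implicit Types f g : B.

Lemma measurable_superlevel f c : measurable [set x | c <= f x].
Proof.
rewrite (_ : [set x | _] = setT `&` f @^-1` `[c, +oo[%classic).
  by apply: (bfun_measurable f) => //; exact: measurable_itv.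
by apply/seteqP; split=> x /=; rewrite in_itv/= andbT//; case.
Qed.

(* A nonnegative bounded function is a nonnegative combination of indicators of
   its superlevel sets up to an error that is uniformly at most [e]. *)
Lemma functional_le_indic (L1 L2 : {scalar B}) c :
  positive_functional L1 -> positive_functional L2 ->
  (forall A (mA : measurable A), c * L1 (bindic R mA) <= L2 (bindic R mA)) ->
  forall f, (forall x, 0 <= f x) -> c * L1 f <= L2 f.
Proof.
move=> L10 L20 L12 f f0.
pose D g := L2 g - c * L1 g.
have DD g h : D (g + h) = D g + D h by rewrite /D (linearD L1) (linearD L2); ring.
have DZ a g : D (a *: g) = a * D g by rewrite /D (linearZ_LR L1) (linearZ_LR L2) /=; ring.
have Dind A (mA : measurable A) : 0 <= D (bindic R mA) by rewrite subr_ge0.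
pose K := L2 (bcst X 1) + `|c| * L1 (bcst X 1).
have Dle e g : (forall x, `|g x| <= e) -> - (K * e) <= D g.
  move=> ge; have := functional_norm_le L10 ge.
  move=> /(ler_wpM2l (normr_ge0 c)); rewrite -normrM => /(le_trans (ler_norm _)).
  have := functional_norm_le L20 ge; rewrite ler_norml => /andP[+ _].
  by rewrite /D /K; lra.
(* Subtracting [e] times the indicator of [e <= g] lowers the ceiling of [g] by [e]. As [D] is
   nonnegative on indicators, the error [K * e] is paid once, at the last level, whatever [m]. *)
have step e : 0 < e -> forall m g, (forall x, 0 <= g x <= m.+1%:R * e) ->
    - (K * e) <= D g.
  move=> e0; elim=> [|m IH] g gm.
    apply: Dle => x; have /andP[g0 ge] := gm x.
    by rewrite ger0_norm// -[e]mul1r.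
  pose r := g - e *: bindic R (measurable_superlevel g e).
  rewrite -[g](subrK (e *: bindic R (measurable_superlevel g e))) DD DZ.
  rewrite (le_trans (IH r _)) ?lerDl ?mulr_ge0 ?Dind ?(ltW e0)// => x.
  have /andP[g0 ge] := gm x.
  rewrite /r !bfunE bindic_val; have [ex|ex] := leP e (g x).
    rewrite mem_set// mulr1 subr_ge0 ex lerBlDr (le_trans ge)//.
    by rewrite -(natr1 m.+1) mulrDl mul1r.
  rewrite memNset; last by apply/negP; rewrite -ltNge.
  by rewrite mulr0 subr0 g0 (le_trans (ltW ex))// ler_peMl ?(ltW e0)// ler1n.
have [b fb] := bfun_bounded f.
rewrite -subr_ge0 -/(D f).
apply: (@ler_add_geometric _ _ _ K 2); first by rewrite ltr1n.
move=> n; have e0 : 0 < 2 ^- n :> R by rewrite invr_gt0 exprn_gt0.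
rewrite -lerBlDr sub0r.
apply: (step _ e0 (Num.bound (`|b| / 2 ^- n))) => x; rewrite f0/=.
rewrite -ler_pdivrMr// (@le_trans _ _ (`|b| / 2 ^- n))//.
  by rewrite ler_pM2r ?invr_gt0// (le_trans (ler_norm _))//
    (le_trans (fb x))// ler_norm.
by rewrite (le_trans (ltW (archi_boundP _))) ?ler_nat// divr_ge0// ltW.
Qed.

(** Carries identities from measurable sets to bounded functions: two inequalities with [c = 1]
    settle nonnegative functions, and adding a constant reduces the rest to them. *)
Lemma functional_eq_indic (L1 L2 : {scalar B}) :
  positive_functional L1 -> positive_functional L2 ->
  (forall A (mA : measurable A), L1 (bindic R mA) = L2 (bindic R mA)) -> L1 =1 L2.
Proof.
move=> L10 L20 L12.
have ge0 f : (forall x, 0 <= f x) -> L1 f = L2 f.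
  move=> f0; apply/eqP; rewrite eq_le -[L1 f]mul1r -[L2 f]mul1r; apply/andP.
  by split; rewrite [leRHS]mul1r; apply: functional_le_indic => // A mA;
    rewrite mul1r L12.
move=> f; have [c fc] := bfun_bounded f.
have fc0 x : 0 <= (f + bcst X c) x.
  by rewrite !bfunE -lerBlDr sub0r; have := fc x; rewrite ler_norml => /andP[].
have c0 x : 0 <= bcst X c x by rewrite bcst_val (le_trans _ (fc x)).
by have := ge0 _ fc0; rewrite (linearD L1) (linearD L2) (ge0 _ c0) => /addIr.
Qed.

End layer_cake.

Section expectation.
Context (d : measure_display) (X : measurableType d) (R : realType).
Notation B := (bfun X R).
Implicit Types f g : B.
Context (mu : {measure set X -> \bar R}).

Lemma bfun_integrable f : (mu setT < +oo)%E -> mu.-integrable setT (EFin \o f).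
Proof.
move=> muoo; apply: measurable_bounded_integrable => //.
  exact: bfun_measurable.
have [c fc] := bfun_bounded f.
exists c; split; first exact: num_real.
by move=> x cx y _; rewrite /= (le_trans (fc y))// ltW.
Qed.

Hypothesis mu1 : mu setT = 1%E.

Let mu_fin : (mu setT < +oo)%E. Proof. by rewrite mu1 ltry. Qed.

Definition expect f := Rintegral mu setT f.

Lemma expect_EFin f : (expect f)%:E = (\int[mu]_x (f x)%:E)%E.
Proof.
by rewrite /expect /Rintegral fineK//; apply: integrable_fin_num => //;
  exact: bfun_integrable.
Qed.

Fact expect_is_linear : scalar expect.
Proof.
move=> a f g; rewrite /expect /= -RintegralZl//; last exact: bfun_integrable.
rewrite -RintegralD//; last exact: bfun_integrable.
exact: (bfun_integrable (a *: f)).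
Qed.

Definition expectation : {scalar B} :=
  HB.pack expect (GRing.isLinear.Build R B R _ expect expect_is_linear).

Lemma expectation_ge0 : positive_functional expectation.
Proof. by move=> f f0; apply: Rintegral_ge0. Qed.

Lemma expectation1 : expectation (bcst X 1) = 1.
Proof. by rewrite /= /expect Rintegral_cst// mu1 mulr1. Qed.

Lemma expectation_ind A (mA : measurable A) :
  (expectation (bindic R mA))%:E = mu A.
Proof. by rewrite expect_EFin /= integral_indic// setIT. Qed.

End expectation.

(** * Kernels as operators *)

Section multiplication.
Context (d : measure_display) (X : measurableType d) (R : realType).
Notation B := (bfun X R).
Implicit Types f g k : B.

Lemma bmulC f g : bmul f g = bmul g f.
Proof. by apply: bfunP => x; rewrite !bfunE mulrC. Qed.

Fact bmul_is_linear f : linear (bmul f).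
Proof. by move=> a g k; apply: bfunP => x; rewrite !bfunE; ring. Qed.

HB.instance Definition _ f := GRing.isLinear.Build R B B _ (bmul f) (bmul_is_linear f).

Lemma bfun_nonneg_sub f : exists g k,
  [/\ forall x, 0 <= g x, forall x, 0 <= k x & f = g - k].
Proof.
have [c fc] := bfun_bounded f; exists (f + bcst X c), (bcst X c).
split=> [x|x|]; last by rewrite addrK.
  by rewrite !bfunE -lerBlDr sub0r; have := fc x; rewrite ler_norml => /andP[].
by rewrite bcst_val (le_trans _ (fc x)).
Qed.

Lemma positive_comp (L : B -> R) (T : B -> B) : positive_functional L ->
  positive_operator T -> positive_functional (L \o T).
Proof. by move=> L0 T0 f f0; apply: L0; exact: T0. Qed.

Lemma positive_bmul f : (forall x, 0 <= f x) -> positive_operator (bmul f).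
Proof. by move=> f0 g g0 x; rewrite bfunE mulr_ge0. Qed.

Lemma expect_bindic (mu : {measure set X -> \bar R}) (mu1 : mu setT = 1%E)
    A (mA : measurable A) f :
  (expectation mu1 (bmul (bindic R mA) f))%:E = (\int[mu]_(x in A) (f x)%:E)%E.
Proof.
rewrite expect_EFin// [RHS]integral_mkcond; apply: eq_integral => x _.
by rewrite bmul_val bindic_val patchE; case: ifP => _; rewrite ?mul1r ?mul0r.
Qed.

(** As a positive functional, evaluation lets [functional_eq_indic] prove pointwise identities
    between operators. *)
Definition eval (x : X) f : R := f x.

Fact eval_is_linear x : scalar (eval x). Proof. by []. Qed.

HB.instance Definition _ x := GRing.isLinear.Build R B R _ (eval x) (eval_is_linear x).

End multiplication.

Section kernel_operator.
Context (d : measure_display) (X : measurableType d) (R : realType).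
Notation B := (bfun X R).
Implicit Types f g k : B.
Context (P : R.-pker X ~> X).

Lemma kernel_setT x : P x setT = 1%E.
Proof. exact: prob_kernel. Qed.

(** Measurability in the starting point is first obtained for nonnegative integrands, hence the
    splitting of [f] into a difference. *)
Fact kop_subproof f :
  (fun x => expectation (kernel_setT x) f) \in @bounded_measurable _ X R.
Proof.
have [c fc] := bfun_bounded f.
apply/bounded_measurableP; split; last first.
  exists c => x; rewrite -[c]mulr1 -(expectation1 (kernel_setT x)).
  by apply: functional_norm_le => //; exact: expectation_ge0.
have nonneg g : (forall x, 0 <= g x) ->
    measurable_fun setT (fun x => expectation (kernel_setT x) g).
  move=> g0; apply: (measurableT_comp (fine_measurable measurableT)) => /=.
  apply: measurable_fun_integral_kernel.
  - by move=> U mU; exact: measurable_kernel.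
  - by move=> z; rewrite lee_fin.
  - by apply/measurable_EFinP; exact: bfun_measurable.
have [g [k [g0 k0 ->]]] := bfun_nonneg_sub f.
under eq_fun do rewrite linearB.
by apply: measurable_funB; exact: nonneg.
Qed.

Definition kop f := BFun (kop_subproof f).

Lemma kopE f x : kop f x = expectation (kernel_setT x) f.
Proof. by []. Qed.

Fact kop_is_linear : linear kop.
Proof. by move=> a f g; apply: bfunP => x; rewrite kopE linearP. Qed.

HB.instance Definition _ := GRing.isLinear.Build R B B _ kop kop_is_linear.

Lemma kop_ge0 : positive_operator kop.
Proof. by move=> f f0 x; exact: expectation_ge0. Qed.

Lemma kop1 : kop (bcst X 1) = bcst X 1.
Proof. by apply: bfunP => x; rewrite kopE expectation1. Qed.

Lemma kop_ind A (mA : measurable A) x : (kop (bindic R mA) x)%:E = P x A.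
Proof. exact: expectation_ind. Qed.

End kernel_operator.

Section kernel_identities.
Context (d : measure_display) (X : measurableType d) (R : realType).
Notation B := (bfun X R).
Implicit Types f g k : B.
Context (P : R.-pker X ~> X) (pi : probability X R).

Lemma expect_kpow n x f :
  expectation (kernel_setT (kpow P n) x) f = iter n (kop P) f x.
Proof.
elim: n x f => [|n IH] x f.
  apply: (functional_eq_indic (L2 := eval x)) f.
  - exact: expectation_ge0.
  - by move=> f; exact.
  - move=> A mA; apply: EFin_inj; rewrite expectation_ind.
    rewrite -[RHS]/(bindic R mA x)%:E bindic_val.
    by rewrite /= /kdirac/= diracE.
apply: (functional_eq_indic (L2 := eval x \o iter n.+1 (kop P))) f.
- exact: expectation_ge0.
- apply: positive_comp; first by move=> f; exact.
  by apply: positive_iter; exact: kop_ge0.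
- move=> A mA; apply: EFin_inj; rewrite expectation_ind.
  rewrite -[RHS]/(kop P (iter n (kop P) (bindic R mA)) x)%:E kopE expect_EFin ?kernel_setT//.
  apply: eq_integral => y _.
  by rewrite -IH expectation_ind.
Qed.

Lemma invariant_expect : invariant_prob P pi -> forall f,
  expectation (probability_setT pi) (kop P f) = expectation (probability_setT pi) f.
Proof.
move=> inv; apply: (functional_eq_indic
  (L1 := expectation (probability_setT pi) \o kop P)).
- by apply: positive_comp; [exact: expectation_ge0|exact: kop_ge0].
- exact: expectation_ge0.
- move=> A mA; apply: EFin_inj; rewrite [RHS]expectation_ind.
  apply: etrans (esym (inv A mA)); rewrite [LHS](expect_EFin (probability_setT pi)).
  by apply: eq_integral => x _; rewrite kop_ind.
Qed.

(** Rectangles give indicators in both arguments. Positivity frees one argument at a time: first [g]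
    with [f] an indicator, then [f] with [g] nonnegative, and finally [g] by splitting it. *)
Lemma reversible_expect : reversible_kernel P pi -> forall f g,
  expectation (probability_setT pi) (bmul f (kop P g)) =
  expectation (probability_setT pi) (bmul (kop P f) g).
Proof.
move=> rev; set E := expectation _.
have E0 : positive_functional E by exact: expectation_ge0.
have P0 := @kop_ge0 _ _ _ P.
have bmulP0 f : (forall x, 0 <= f x) -> positive_operator (bmul f \o kop P).
  by move=> f0 g g0; apply: positive_bmul => //; exact: P0.
have ind0 (A : set X) (mA : measurable A) x : 0 <= bindic R mA x by rewrite bindic_val.
have step1 A (mA : measurable A) g :
    E (bmul (bindic R mA) (kop P g)) = E (bmul (kop P (bindic R mA)) g).
  apply: (functional_eq_indic (L1 := E \o (bmul (bindic R mA) \o kop P))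
    (L2 := E \o bmul (kop P (bindic R mA)))) g.
  - by apply: positive_comp => //; exact: bmulP0.
  - by apply: positive_comp => //; apply: positive_bmul; exact: P0.
  - move=> C mC; apply: EFin_inj; rewrite /= [in RHS]bmulC !(expect_bindic (probability_setT pi)).
    under eq_integral do rewrite kop_ind.
    by under [RHS]eq_integral do rewrite kop_ind; exact: rev.
have step2 f g : (forall x, 0 <= g x) ->
    E (bmul f (kop P g)) = E (bmul (kop P f) g).
  move=> g0; rewrite bmulC (bmulC _ g).
  apply: (functional_eq_indic (L1 := E \o bmul (kop P g))
    (L2 := E \o (bmul g \o kop P))) f.
  - by apply: positive_comp => //; apply: positive_bmul; exact: P0.
  - by apply: positive_comp => //; exact: bmulP0.
  - by move=> C mC; rewrite -[LHS]/(E (bmul (kop P g) (bindic R mC))) bmulC step1 bmulC.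
move=> f g; have [g1 [g2 [g10 g20 ->]]] := bfun_nonneg_sub g.
by rewrite [kop P _]linearB ![bmul _ (_ - _)]linearB !(linearB E) !step2.
Qed.

Lemma bfun_Lfun2 f : (f : X -> R) \in Lfun pi 2%:E.
Proof.
rewrite inE; apply/andP; split; rewrite inE/=; first exact: bfun_measurable.
rewrite /finite_norm unlock poweR_lty//.
under eq_integral => x _.
  rewrite /= powR_mulrn// real_normK ?num_real// expr2 -bmul_val.
  over.
apply: integrable_lty => //; apply: bfun_integrable.
by rewrite [X in (X < _)%E](probability_setT pi) ltry.
Qed.

Lemma nonneg_definite_expect : nonneg_definite_kernel P pi -> forall f,
  0 <= expectation (probability_setT pi) (bmul f (kop P f)).
Proof. by move=> nnd f; apply: nnd; exact: bfun_Lfun2. Qed.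

Lemma minorization_expect (nu : probability X R) (A : set X) (mA : measurable A)
    (delta : R) :
  (forall x B, measurable B -> ((delta * \1_A x)%:E * nu B <= P x B)%E) ->
  forall f, (forall x, 0 <= f x) -> forall x,
  delta * expectation (probability_setT nu) f * bindic R mA x <= kop P f x.
Proof.
move=> hmin f f0 x; rewrite mulrAC kopE.
apply: functional_le_indic => //; [exact: expectation_ge0..|].
move=> C mC; rewrite -lee_fin EFinM !expectation_ind.
exact: hmin.
Qed.

End kernel_identities.

(** * Densities *)

Section density.
Context (d : measure_display) (X : measurableType d) (R : realType).
Notation B := (bfun X R).
Implicit Types f g k : B.

(** A Radon-Nikodym density is at most [c] only almost everywhere; truncating it at [c] gives an
    everywhere bounded version. Where the truncation equals [c] the bound on [nu] applies, and
    elsewhere nothing was cut off. *)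
Lemma bounded_density (nu pi : probability X R) (c : R) : 0 <= c ->
  (forall A, measurable A -> (nu A <= c%:E * pi A)%E) ->
  exists h : B, [/\ forall x, 0 <= h x, forall x, h x <= c &
    forall f, expectation (probability_setT nu) f =
      expectation (probability_setT pi) (bmul h f)].
Proof.
move=> c0 nu_le.
have dom : nu `<< pi.
  apply/null_content_dominatesP => A mA piA0; apply/eqP; rewrite eq_le measure_ge0.
  by rewrite andbT (le_trans (nu_le A mA))// piA0 mule0.
have [F [F0 Ffin intF nuF]] := radon_nikodym_sigma_finite dom.
have {}nuF A : measurable A -> nu A = (\int[pi]_(x in A) F x)%E by exact: nuF.
pose g x := fine (F x).
have gE x : F x = (g x)%:E by rewrite fineK.
have g0 x : 0 <= g x by rewrite fine_ge0.
have mg : measurable_fun setT g.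
  apply/measurable_EFinP; rewrite (_ : EFin \o g = F); last exact/funext.
  exact: measurable_int intF.
have hP : (fun x => Num.min (g x) c) \in @bounded_measurable _ X R.
  apply/bounded_measurableP; split; first exact: measurable_minr.
  by exists c => x; rewrite ger0_norm ?ge_min ?lexx ?orbT// le_min g0.
pose h : B := BFun hP.
have h0 x : 0 <= h x by rewrite /h /= le_min g0.
have hc x : h x <= c by rewrite /h /= ge_min lexx orbT.
have hg x : h x <= g x by rewrite /h /= ge_min lexx.
have hgE x : h x < c -> h x = g x.
  by rewrite /h /= minElt; case: ifP => //; rewrite ltxx.
exists h; split=> //.
have nuE A : measurable A -> nu A = (\int[pi]_(x in A) (h x)%:E)%E.
  move=> mA; apply/eqP; rewrite eq_le; apply/andP; split; last first.
    apply: (@le_trans _ _ (\int[pi]_(x in A) F x)%E); last by rewrite -nuF.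
    apply: ge0_le_integral => //.
    - by move=> x _; rewrite lee_fin.
    - by apply/measurable_EFinP; apply: measurable_funTS; exact: bfun_measurable.
    - by apply: measurable_funTS; exact: measurable_int intF.
    - by move=> x _; rewrite gE lee_fin.
  pose S := [set x | c <= h x].
  have mS : measurable S by exact: measurable_superlevel.
  have mAS : measurable (A `&` S) by exact: measurableI.
  have mASc : measurable (A `&` ~` S) by apply: measurableI => //; exact: measurableC.
  have AE : A = (A `&` S) `|` (A `&` ~` S) by rewrite -setIUr setUv setIT.
  rewrite [in leRHS]AE ge0_integral_setU//; last 3 first.
  - by apply/measurable_EFinP; apply: measurable_funTS; exact: bfun_measurable.
  - by move=> x _; rewrite lee_fin.
  - by apply/disj_setPS => x [[_ ?] [_]].
  rewrite [in leLHS]AE measureU//; last first.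
    by apply/seteqP; split=> // x [[_ ?] [_]].
  apply: leeD.
    rewrite (le_trans (nu_le _ mAS))// -integral_cst// le_eqVlt; apply/orP; left.
    apply/eqP; apply: eq_integral => x /set_mem[_ cx].
    by congr EFin; apply/eqP; rewrite eq_le hc cx.
  apply: (@le_trans _ _ (\int[pi]_(x in A `&` ~` S) F x)%E); first by rewrite -nuF.
  rewrite le_eqVlt; apply/orP; left; apply/eqP.
  apply: eq_integral => x /set_mem[_ /negP]; rewrite -ltNge => cx.
  by rewrite gE hgE.
apply: (functional_eq_indic (L2 := expectation (probability_setT pi) \o bmul h)).
- exact: expectation_ge0.
- by apply: positive_comp; [exact: expectation_ge0|exact: positive_bmul].
- move=> A mA; apply: EFin_inj; rewrite expectation_ind.
  rewrite -[RHS]/(expectation (probability_setT pi) (bmul h (bindic R mA)))%:E.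
  by rewrite bmulC expect_bindic; exact: nuE.
Qed.

(** Integrate the minorization against [pi]; invariance turns the right side into [pi C]. *)
Lemma minorization_density (P : R.-pker X ~> X) (nu pi : probability X R)
    (A : set X) (mA : measurable A) (delta : R)
    (a := expectation (probability_setT pi) (bindic R mA)) :
  0 < delta * a -> invariant_prob P pi ->
  (forall x B, measurable B -> ((delta * \1_A x)%:E * nu B <= P x B)%E) ->
  forall C, measurable C -> (nu C <= (delta * a)^-1%:E * pi C)%E.
Proof.
move=> da inv hmin C mC.
have nuC := expectation_ind (probability_setT nu) mC.
have piC := expectation_ind (probability_setT pi) mC.
rewrite -[X in (X <= _)%E]nuC -[X in (_ <= _ * X)%E]piC lee_fin ler_pdivlMl//.
rewrite -(invariant_expect inv (bindic R mC)) mulrAC.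
set nC := expectation _ (bindic R mC).
have -> : delta * nC * a = expectation (probability_setT pi) ((delta * nC) *: bindic R mA).
  by rewrite linearZ.
apply: functional_le; first exact: expectation_ge0.
move=> x; rewrite bfunZ; apply: (minorization_expect mA hmin) => y.
by rewrite bindic_val.
Qed.

End density.

(** * Hitting times of a Markov chain *)

Section integral_monotone.
Import HBNNSimple.

(** The integral of a nonnegative function is a supremum over simple functions below it, so
    monotonicity asks for no measurability. It is applied with [hitting_time] on the larger side. *)
Lemma ge0_le_integral_nonmeasurable (d : measure_display) (T : measurableType d)
    (R : realType) (mu : {measure set T -> \bar R}) (f g : T -> \bar R) :
  (forall x, 0 <= f x)%E -> (forall x, f x <= g x)%E ->
  (\int[mu]_x f x <= \int[mu]_x g x)%E.
Proof.
move=> f0 fg; have g0 x : (0 <= g x)%E by rewrite (le_trans (f0 x)).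
rewrite !ge0_integralE//; apply: ge_ereal_sup => _ [h /= hf <-].
apply: le_ereal_sup_tmp; exists (sintegral mu h) => //; exists h => //= x.
by rewrite (le_trans (hf x))// !patchE in_setT.
Qed.

End integral_monotone.

Section composition.
Context (d1 d2 : measure_display) (T1 : measurableType d1) (T2 : measurableType d2).
Context (R : realType) (phi : T1 -> T2) (mphi : measurable_fun setT phi).

Fact bcomp_subproof (f : bfun T2 R) :
  (fun w => f (phi w)) \in @bounded_measurable _ T1 R.
Proof.
apply/bounded_measurableP; split.
  by apply: measurableT_comp => //; exact: bfun_measurable.
by have [c fc] := bfun_bounded f; exists c.
Qed.

Definition bcomp f := BFun (bcomp_subproof f).

Lemma bcomp_val f w : bcomp f w = f (phi w).
Proof. by []. Qed.

Fact bcomp_is_linear : linear bcomp.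
Proof. by move=> a f g; apply: bfunP. Qed.

HB.instance Definition _ := GRing.isLinear.Build R _ _ _ bcomp bcomp_is_linear.

Lemma bcomp_ge0 (f : bfun T2 R) : (forall x, 0 <= f x) -> forall w, 0 <= bcomp f w.
Proof. by move=> f0 w; exact: f0. Qed.

End composition.

Section hitting.
Context (dX dO : measure_display) (X : measurableType dX)
  (Omega : measurableType dO) (R : realType).
Context (P : R.-pker X ~> X) (Pr : X -> probability Omega R)
  (Phi : nat -> Omega -> X) (hPhi : markov_chain P Pr Phi)
  (A : set X) (mA : measurable A) (x : X).

Implicit Types f : bfun X R.

Let mPhi n : measurable_fun setT (Phi n).
Proof. exact: markov_chain_measurable hPhi n. Qed.
Let E := expectation (probability_setT (Pr x)).
Let E0 : positive_functional E. Proof. exact: expectation_ge0. Qed.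
Let iA := bindic R mA.

(** This is the event that [hitting_time] exceeds [n]; the recursion exhibits it as part of the
    history up to time [n]. *)
Fixpoint outside n : set Omega :=
  if n is m.+1 then outside m `&` Phi n @^-1` (~` A) else Phi 0%N @^-1` (~` A).

Let mpreim n (B : set X) : measurable B -> measurable (Phi n @^-1` B).
Proof. by move=> mB; rewrite -[X in measurable X]setTI; exact: mPhi. Qed.

Let measurable_outside n : measurable (outside n).
Proof.
have mAc : measurable (~` A) by exact: measurableC.
by elim: n => [|n IH] /=; [exact: mpreim|apply: measurableI => //; exact: mpreim].
Qed.

Let history_outside n : history Phi n (outside n).
Proof.
have hist_preim m k (B : set X) : (k <= m)%N -> measurable B ->
    history Phi m (Phi k @^-1` B).
  by move=> km mB; apply: sub_sigma_algebra; exists k, B.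
have mAc : measurable (~` A) by exact: measurableC.
have hist_le m : history Phi m `<=` history Phi m.+1.
  apply: sub_sigma_algebra2 => _ [k [B [km mB ->]]].
  by exists k, B; split=> //; rewrite (leq_trans km).
elim: n => [|n IH] /=; first exact: hist_preim.
by apply: (@measurableI _ (g_sigma_algebraType _)); [exact: hist_le|exact: hist_preim].
Qed.

Let W n := bindic R (measurable_outside n).

Let one_step n f :
  E (bmul (W n) (bcomp (mPhi n.+1) f)) = E (bmul (W n) (bcomp (mPhi n) (kop P f))).
Proof.
have W0 k w : 0 <= W k w by rewrite bindic_val.
apply: (functional_eq_indic (L1 := E \o (bmul (W n) \o bcomp (mPhi n.+1)))
  (L2 := E \o (bmul (W n) \o (bcomp (mPhi n) \o kop P)))).
- by move=> g g0; apply: E0; apply: positive_bmul => //; exact: bcomp_ge0.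
- move=> g g0; apply: E0; apply: positive_bmul => //; apply: bcomp_ge0.
  exact: kop_ge0.
- move=> B mB; apply: EFin_inj.
  rewrite [LHS](expect_bindic (probability_setT (Pr x))).
  rewrite [RHS](expect_bindic (probability_setT (Pr x))).
  rewrite [LHS](_ : _ = Pr x (outside n `&` Phi n.+1 @^-1` B)).
    rewrite (markov_chain_step hPhi x (@history_outside n) mB).
    by apply: eq_integral => w _; rewrite bcomp_val kop_ind.
  by rewrite setIC -integral_indic//; exact: mpreim.
Qed.

Let init f : E (bcomp (mPhi 0) f) = f x.
Proof.
apply: (functional_eq_indic (L1 := E \o bcomp (mPhi 0)) (L2 := eval x)) f.
- by move=> g g0; apply: E0; exact: bcomp_ge0.
- by move=> g; exact.
- move=> B mB; apply: EFin_inj.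
  rewrite [LHS](expect_EFin (probability_setT (Pr x))).
  rewrite -[RHS]/((bindic R mB x)%:E) bindic_val -indicE -diracE.
  rewrite -(markov_chain_init hPhi x mB) -[Phi _ @^-1` _]setIT.
  by rewrite -integral_indic//; exact: mpreim.
Qed.

Let not_in_A n w : outside n w -> ~ A (Phi n w).
Proof. by case: n => [|n] //= []. Qed.

Let W_out n f : bmul (W n) (bcomp (mPhi n) (bmul (bcst X 1 - iA) f)) =
  bmul (W n) (bcomp (mPhi n) f).
Proof.
apply: bfunP => w.
rewrite [LHS](_ : _ = W n w * ((1 - iA (Phi n w)) * f (Phi n w)))//.
rewrite [RHS](_ : _ = W n w * f (Phi n w))// !bindic_val.
have [/set_mem /not_in_A nA|] := boolP (w \in outside n); last by rewrite !mul0r.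
by rewrite (memNset nA) subr0 !mul1r.
Qed.

Let W_step n f : bmul (W n) (bcomp (mPhi n.+1) (bmul (bcst X 1 - iA) f)) =
  bmul (W n.+1) (bcomp (mPhi n.+1) f).
Proof.
apply: bfunP => w.
rewrite [LHS](_ : _ = W n w * ((1 - iA (Phi n.+1 w)) * f (Phi n.+1 w)))//.
rewrite [RHS](_ : _ = W n.+1 w * f (Phi n.+1 w))// mulrA; congr (_ * _).
rewrite !bindic_val.
rewrite /= in_setI; case: (w \in outside n); rewrite ?mul0r// mul1r/=.
have -> : (w \in Phi n.+1 @^-1` (~` A)) = (Phi n.+1 w \in ~` A).
  by apply/idP/idP => /set_mem ?; apply/mem_set.
rewrite in_setC.
by case: (_ \in A); rewrite ?subrr ?subr0.
Qed.

Let one_subM f : bmul (bcst X 1 - iA) (bmul (bcst X 1 - iA) f) = bmul (bcst X 1 - iA) f.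
Proof.
apply: bfunP => y; rewrite !bfunE bindic_val.
by case: (_ \in _); rewrite ?subrr ?subr0 ?mul0r ?mul1r.
Qed.

Let survival_out j : survival (kop P) iA j = bmul (bcst X 1 - iA) (survival (kop P) iA j).
Proof.
case: j => [|j]; last by rewrite survivalS one_subM.
by apply: bfunP => y; rewrite survival0 !bfunE bindic_val; case: (_ \in _);
  rewrite ?subrr ?subr0 ?mul0r ?mul1r.
Qed.

(** Each [P] inside [survival] is traded for one step of the chain, and a factor [1 - iA] turns
    [W n] into [W n.+1]. *)
Let survival_chain j n :
  E (bmul (W n) (bcomp (mPhi n) (survival (kop P) iA j))) = E (W (n + j)).
Proof.
elim: j n => [|j IH] n.
  rewrite addn0 survival_out W_out survival0; congr (E _); apply: bfunP => w.
  rewrite [LHS](_ : _ = W n w * (1 - iA (Phi n w)))// !bindic_val.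
  have [/set_mem /not_in_A nA|] := boolP (w \in outside n); last by rewrite mul0r.
  by rewrite (memNset nA) subr0 !mul1r.
by rewrite survivalS W_out -one_step survival_out W_step IH addSnnS.
Qed.

Lemma survivalE j : survival (kop P) iA j x = E (W j).
Proof.
rewrite -init -[j in RHS]add0n -survival_chain; congr (E _); apply: bfunP => w.
rewrite survival_out; set f := survival _ _ _.
rewrite [LHS](_ : _ = (1 - iA (Phi 0%N w)) * f (Phi 0%N w))//.
rewrite [RHS](_ : _ = W 0%N w * ((1 - iA (Phi 0%N w)) * f (Phi 0%N w)))//.
rewrite !bindic_val /=.
case: (boolP (w \in _)) => [_|/negP h]; rewrite ?mul1r ?mul0r//.
suff -> : Phi 0%N w \in A by rewrite subrr mul0r.
apply: contrapT => /negP nA; apply: h.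
by rewrite mem_set //= => /mem_set h; rewrite h in nA.
Qed.

(** Pathwise, the number of [j < m] with [W j = 1] is at most [minn m n] for every visit time [n] to
    [A]; a path that never visits [A] has infinite hitting time. *)
Lemma sum_survival_le m :
  ((\sum_(j < m) survival (kop P) iA j x)%:E <=
   \int[Pr x]_w hitting_time Phi A w)%E.
Proof.
under eq_bigr do rewrite survivalE.
rewrite -linear_sum (expect_EFin (probability_setT (Pr x))).
apply: ge0_le_integral_nonmeasurable => w.
  by rewrite lee_fin bfun_sum sumr_ge0// => j _; rewrite bindic_val.
apply/ereal_infP => _ [n An <-]; rewrite lee_fin bfun_sum.
have W_lt j : W j w <= (j < n)%:R.
  rewrite bindic_val; case: ltnP => nj; first by case: (_ \in _).
  rewrite memNset// => wj; suff /not_in_A : outside n w by [].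
  elim: j nj wj => [|j IH]; first by rewrite leqn0 => /eqP ->.
  by rewrite leq_eqVlt => /predU1P[->//|nj [wj _]]; exact: IH.
apply: (@le_trans _ _ (\sum_(j < m) (j < n)%:R)); first exact: ler_sum.
rewrite -natr_sum ler_nat.
rewrite (_ : (\sum_(j < m) (j < n) = minn m n)%N) ?geq_minr//.
elim: m => [|m IH]; first by rewrite big_ord0 min0n.
by rewrite big_ord_recr /= IH; lia.
Qed.

End hitting.

(** * Perturbation *)

Section variation.
Context (d : measure_display) (X : measurableType d) (R : realType).
Notation B := (bfun X R).
Implicit Types f g : B.

Lemma var_distE (m1 m2 : {measure set X -> \bar R}) (h1 : m1 setT = 1%E)
    (h2 : m2 setT = 1%E) : var_dist m1 m2 =
  ereal_sup [set `|expectation h1 f - expectation h2 f|%:E |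
    f in [set f : B | forall x, `|f x| <= 1]].
Proof.
have distE f : `|expectation h1 f - expectation h2 f|%:E =
    `|\int[m1]_x (f x)%:E - \int[m2]_x (f x)%:E|%E.
  by rewrite -(expect_EFin h1) -(expect_EFin h2).
congr ereal_sup; apply/seteqP; split=> [_ [f [mf f1] <-]|_ [f f1 <-]].
  have hf : f \in @bounded_measurable _ X R.
    by apply/bounded_measurableP; split=> //; exists 1.
  by exists (BFun hf); rewrite ?distE.
by exists f; rewrite ?distE//; split=> //; exact: bfun_measurable.
Qed.

Context (P Q : R.-pker X ~> X).

Lemma kernel_dist_fin_num : kernel_dist P Q \is a fin_num.
Proof.
have E1 (m : {measure set X -> \bar R}) (m1 : m setT = 1%E) f :
    (forall x, `|f x| <= 1) -> `|expectation m1 f| <= 1.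
  by move=> /(functional_norm_le (expectation_ge0 m1)); rewrite expectation1 mul1r.
rewrite fin_numE; apply/andP; split; apply/eqP => kd.
  have : (0 <= kernel_dist P Q)%E; last by rewrite kd.
  (* [X] is pointed; over an empty space the supremum would be [-oo]. *)
  apply: le_ereal_sup_tmp; exists (var_dist (P point) (Q point)); first by exists point.
  set h1 := kernel_setT P point; set h2 := kernel_setT Q point.
  rewrite (var_distE h1 h2); apply: le_ereal_sup_tmp.
  exists `|expectation h1 (0 : B) - expectation h2 (0 : B)|%:E; last first.
    by rewrite lee_fin.
  by exists 0 => // x; rewrite bfun0 normr0.
have : (kernel_dist P Q <= 2%:E)%E; last by rewrite kd.
apply: ge_ereal_sup => _ [x _ <-].
rewrite (var_distE (kernel_setT P x) (kernel_setT Q x)).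
apply: ge_ereal_sup => _ [f f1 <-]; rewrite lee_fin.
rewrite (le_trans (ler_normB _ _))// (_ : 2 = 1 + 1)// lerD// E1//.
Qed.

Lemma kop_dist_le f c x : (forall y, `|f y| <= c) ->
  `|kop P f x - kop Q f x| <= c * fine (kernel_dist P Q).
Proof.
move=> fc; have c0 : 0 <= c by rewrite (le_trans _ (fc x)).
have le1 g : (forall y, `|g y| <= 1) ->
    `|kop P g x - kop Q g x| <= fine (kernel_dist P Q).
  move=> g1; rewrite -lee_fin fineK ?kernel_dist_fin_num//.
  apply: le_ereal_sup_tmp; exists (var_dist (P x) (Q x)); first by exists x.
  rewrite (var_distE (kernel_setT P x) (kernel_setT Q x)).
  by apply: ereal_sup_ubound; exists g.
move: c0; rewrite le_eqVlt => /predU1P[c0|c0].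
  have -> : f = 0.
    by apply: bfunP => y; apply/eqP; rewrite bfun0 -normr_le0 c0.
  by rewrite (linear0 (kop P)) (linear0 (kop Q)) subrr normr0 -c0 mul0r.
have := le1 (c^-1 *: f) _.
rewrite ![kop _ _]linearZ !bfunZ -mulrBr normrM gtr0_norm ?invr_gt0//.
rewrite ler_pdivrMl//; apply=> y.
by rewrite bfunZ normrM gtr0_norm ?invr_gt0// ler_pdivrMl// mulr1.
Qed.

Let e := fine (kernel_dist P Q).

(* With [T = kop P], [S = kop Q]: T^(n+1) - S^(n+1) = T (T^n - S^n) + (T - S) S^n, and
   [T - S] kills constants, so that [S^n f] may be replaced by [S^n f - c]. *)
Lemma iter_kop_dist_le (r : nat -> R) f c :
  (forall n x, `|iter n (kop Q) f x - c| <= r n) ->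
  forall n x, `|iter n (kop P) f x - iter n (kop Q) f x| <= (\sum_(k < n) r k) * e.
Proof.
move=> hr n; elim: n => [|n IH] x.
  by rewrite big_ord0 mul0r subrr normr0.
set u := iter n (kop P) f; set w := iter n (kop Q) f.
have -> : iter n.+1 (kop P) f x - iter n.+1 (kop Q) f x =
    kop P (u - w) x + (kop P (w - bcst X c) x - kop Q (w - bcst X c) x).
  rewrite ![kop _ (_ - _)]linearB !bfunD !bfunN.
  have cst (T : R.-pker X ~> X) : kop T (bcst X c) x = c.
    have -> : kop T (bcst X c) = c *: kop T (bcst X 1).
      by rewrite bcstE; exact: linearZ.
    by rewrite kop1 bfunZ bcst_val mulr1.
  by rewrite !cst -/u -/w /=; ring.
rewrite big_ord_recr mulrDl (le_trans (ler_normD _ _))// lerD//.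
  rewrite -[leRHS]mulr1 -[X in _ <= _ * X](bcst_val 1 x) -(kop1 P).
  apply: operator_norm_le => [|y]; first exact: kop_ge0.
  by rewrite !bfunE.
by apply: kop_dist_le => y; exact: hr.
Qed.

End variation.

(** * Arithmetic-geometric sums and the perturbation bounds *)

Lemma arithmetic_geometric_sum (R : realFieldType) (D E lam : R) n : 1 < lam ->
  \sum_(k < n) (D + E * k%:R) * lam ^- k =
  lam / (lam - 1) * (D + E / (lam - 1) - (D + E / (lam - 1) + E * n%:R) * lam ^- n).
Proof.
move=> lam1; have lam0 : lam != 0 by rewrite gt_eqF// (lt_trans ltr01).
have lam10 : lam - 1 != 0 by rewrite subr_eq0 gt_eqF.
elim: n => [|n IH]; first by rewrite big_ord0 expr0; field.
rewrite big_ord_recr/= IH -natr1 exprS; field.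
by rewrite lam0 lam10 expf_neq0.
Qed.

(** Half of the decay absorbs the linear factor: with [mu = Num.sqrt lam], Bernoulli gives
    [n%:R * (mu - 1) <= mu ^+ n]. The result has the form that [ler_add_geometric] asks for. *)
Lemma arithmetic_geometric_le (R : realType) (D E lam : R) : 1 < lam ->
  0 <= D -> 0 <= E -> exists C mu, 1 < mu /\
  forall n, (D + E * n%:R) * lam ^- n <= C * mu ^- n.
Proof.
move=> lam1 D0 E0; pose mu := Num.sqrt lam.
have mu1 : 1 < mu by rewrite -sqrtr1 ltr_sqrt// (lt_trans ltr01).
have mulam : lam = mu ^+ 2 by rewrite sqr_sqrtr// ltW// (lt_trans ltr01).
exists (D + E / (mu - 1)), mu; split=> // n.
have mun : 0 < mu ^+ n by rewrite exprn_gt0// (lt_trans ltr01).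
have mu10 : 0 < mu - 1 by rewrite subr_gt0.
rewrite mulam exprAC expr2 invfM mulrA ler_pM2r ?invr_gt0//.
rewrite ler_pdivrMr// mulrDl lerD//.
  by rewrite ler_peMr// exprn_ege1// ltW.
rewrite -mulrA ler_wpM2l// ler_pdivlMl//.
have := bernoulli_exp n (ltW mu10); rewrite subrKC; apply: le_trans.
by rewrite mulrC lerDr.
Qed.

Local Open Scope ereal_scope.

Theorem theorem3p4 (R : realType) (dX : measure_display)
  (X : measurableType dX) (hX : countably_generated X)
  (P : R.-pker X ~> X) (pi : probability X R)
  (dO : measure_display) (Omega : measurableType dO)
  (Pr : X -> probability Omega R) (Phi : nat -> Omega -> X)
  (hPhi : markov_chain P Pr Phi)
  (hinv : invariant_prob P pi)
  (hirr : irreducible_kernel P pi)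
  (hac : forall (n : nat) (x : X), (1 <= n)%N -> kpow P n x `<< pi)
  (hrev : reversible_kernel P pi)
  (hnnd : nonneg_definite_kernel P pi)
  (A : set X) (mA : measurable A) (hA : 0 < pi A)
  (delta : R) (hdelta : (0 < delta)%R) (nu : probability X R)
  (hmin : forall (x : X) (B : set X), measurable B ->
    (delta * \1_A x)%:E * nu B <= P x B)
  (M : R)
  (hM : ereal_sup [set \int[Pr x]_w hitting_time Phi A w | x in [set: X]]
        = M%:E)
  (Pt : R.-pker X ~> X) (pit : probability X R)
  (hpit : invariant_prob Pt pit)
  (lam : R) (hlam1 : (1 < lam)%R) (hlam2 : lam%:E < expeR (M%:E^-1))
  (hlam3 : (lam < (1 + delta * lam) * (1 - M * ln lam))%R) :
  let D := D2 delta (fine (pi A)) M lam in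
  let E := E2 delta (fine (pi A)) M lam in
  (forall n : nat, (1 <= n)%N ->
    kernel_dist (kpow Pt n) (kpow P n) <=
      (lam / (lam - 1) *
        ((D + E / (lam - 1)) -
         (D + E / (lam - 1) + E * n%:R) * lam ^- n))%:E
      * kernel_dist Pt P) /\
  var_dist pit pi <=
    (lam / (lam - 1) * (D + E / (lam - 1)))%:E * kernel_dist Pt P.
Proof.
move=> D E.
pose Epi := expectation (probability_setT pi).
pose iA := bindic R mA.
have piA : fine (pi A) = Epi iA by rewrite -(expectation_ind (probability_setT pi) mA).
have a0 : (0 < Epi iA)%R.
  by rewrite -lte_fin [X in 0 < X](expectation_ind (probability_setT pi) mA).
have da : (0 < delta * Epi iA)%R by rewrite mulr_gt0.
have M0 : (0 <= M)%R.
  rewrite -lee_fin -hM; apply: le_ereal_sup_tmp.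
  exists (\int[Pr point]_w hitting_time Phi A w); first by exists point.
  by apply: integral_ge0 => w _; apply/ereal_infP => _ [n _ <-]; rewrite lee_fin.
have survivalM m x : (\sum_(n < m) survival (kop P) iA n x <= M)%R.
  rewrite -lee_fin -hM (le_trans (sum_survival_le hPhi mA x m))//.
  by apply: ereal_sup_ubound; exists x.
have da_inv : (0 <= (delta * Epi iA)^-1)%R by rewrite invr_ge0 ltW.
have [h [h0 h_le nuh]] := bounded_density da_inv
  (minorization_density (mA := mA) da hinv hmin).
pose r n := ((D + E * n%:R) * lam ^- n)%R.
have ergodic (f : bfun X R) n x : (forall y, `|f y| <= 1)%R ->
    (`|iter n (kop P) f x - Epi f| <= r n)%R.
  rewrite /r /D /E piA.
  apply: (@uniform_ergodicity _ _ _ (kop P) Epi (expectation (probability_setT nu))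
    iA delta M lam _ _ _ _ _ _ _ _ _ _ _ _ _ _ h) => //.
  - exact: kop_ge0.
  - exact: kop1.
  - exact: expectation_ge0.
  - exact: expectation1.
  - exact: expectation_ge0.
  - exact: expectation1.
  - by move=> y; rewrite bindic_val; case: (_ \in _); [right|left].
  - exact: minorization_expect.
  - exact: invariant_expect.
  - exact: reversible_expect.
  - exact: nonneg_definite_expect.
(* The centring constant in [iter_kop_dist_le] is [Epi f], so the weights of the telescoping sum are
   the ergodic rates [r]. *)
have perturb (f : bfun X R) n x : (forall y, `|f y| <= 1)%R ->
    (`|iter n (kop Pt) f x - iter n (kop P) f x|
      <= (\sum_(k < n) r k) * fine (kernel_dist Pt P))%R.
  by move=> f1; apply: iter_kop_dist_le => k y; exact: ergodic.
have kdE : kernel_dist Pt P = (fine (kernel_dist Pt P))%:E.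
  by rewrite fineK// kernel_dist_fin_num.
rewrite kdE -!EFinM; split=> [n _|].
  rewrite -arithmetic_geometric_sum//.
  apply: ge_ereal_sup => _ [x _ <-].
  rewrite (var_distE (kernel_setT (kpow Pt n) x) (kernel_setT (kpow P n) x)).
  by apply: ge_ereal_sup => _ [f f1 <-]; rewrite lee_fin !expect_kpow perturb.
have lam0 : (0 < lam)%R by rewrite (lt_trans ltr01).
have C0 : (0 <= C2 delta (fine (pi A)))%R by exact: sqrtr_ge0.
have M2_ge0 : (0 <= M2 delta M lam)%R.
  by rewrite divr_ge0// ?subr_ge0 ?mulr_ge0// ltW.
have E_ge0 : (0 <= E)%R.
  apply: mulr_ge0 => //; apply: mulr_ge0 => //.
  by rewrite subr_ge0 invf_le1// ltW.
have D_ge0 : (0 <= D)%R.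
  apply: addr_ge0 => //; apply: mulr_ge0 => //.
  by rewrite mulr_ge0 ?invr_ge0 ?(ltW lam0)// le_max lexx orbT.
have e_ge0 : (0 <= fine (kernel_dist Pt P))%R.
  have one1 (y : X) : (`|(0 : bfun X R) y| <= 1)%R by rewrite bfun0 normr0.
  have := kop_dist_le Pt P point one1; rewrite mul1r; exact: le_trans.
rewrite (var_distE (probability_setT pit) (probability_setT pi)).
apply: ge_ereal_sup => _ [f f1 <-]; rewrite lee_fin.
have [C [mu [mu1 r_le]]] := arithmetic_geometric_le hlam1 D_ge0 E_ge0.
(* [Epit f = Epit (iter n (kop Pt) f)] is compared with [Epi f] through [iter n (kop P) f]. The
   perturbation costs a partial sum of [r] times the distance, and the ergodic error [r n] vanishes
   as [n] grows. *)
apply: (ler_add_geometric (c := C) mu1) => n.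
pose Epit := expectation (probability_setT pit).
have pit_iter : Epit (iter n (kop Pt) f) = Epit f.
  elim: n => // n IH; exact: etrans (invariant_expect hpit _) IH.
have pit_cst c : Epit (bcst X c) = c.
  by rewrite bcstE (linearZ_LR Epit) [Epit _]expectation1 mulr1.
have -> : (Epit f - Epi f = Epit (iter n (kop Pt) f - bcst X (Epi f)))%R.
  by rewrite linearB pit_cst pit_iter.
have step y : (`|(iter n (kop Pt) f - bcst X (Epi f)) y| <=
    (\sum_(k < n) r k) * fine (kernel_dist Pt P) + r n)%R.
  rewrite !bfunE -(subrKA (iter n (kop P) f y)).
  by rewrite (le_trans (ler_normD _ _))// lerD ?perturb ?ergodic.
have := functional_norm_le (expectation_ge0 (probability_setT pit)) step.
rewrite expectation1 mulr1 => /le_trans; apply; apply: lerD; last exact: r_le.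
(* The partial sum is bounded by its limit, by dropping the nonnegative subtracted term. *)
apply: ler_wpM2r => //; rewrite arithmetic_geometric_sum//.
rewrite ler_wpM2l ?divr_ge0 ?subr_ge0 ?(ltW lam0) ?(ltW hlam1)//.
rewrite gerBl mulr_ge0 ?invr_ge0 ?exprn_ge0 ?(ltW lam0)//.
apply: addr_ge0; last exact: mulr_ge0.
by apply: addr_ge0 => //; apply: divr_ge0 => //; rewrite subr_ge0 ltW.
Qed.
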